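(* Let $m\ge 2$, $n\ge 1$ and let $\mathcal{A}=(a_{i_1\cdots i_m})\in T_{m,n}$ be a nonnegative tensor (all entries $\ge 0$). Then the following are equivalent: (i) $\mathcal{A}$ is a Q-tensor; (ii) $\mathcal{A}$ is an R-tensor; (iii) $\mathcal{A}$ is a strictly semi-positive tensor; (iv) $a_{ii\cdots i}>0$ for all $i\in I_n$.
   Context: $T_{m,n}$ is the set of real $m$th order $n$-dimensional tensors $\mathcal{A}=(a_{i_1\cdots i_m})$, with real entries indexed by $i_1,\ldots,i_m\in I_n:=\{1,\ldots,n\}$ (no symmetry assumed). For $\mathbf{x}\in\mathbb{R}^n$, $\mathcal{A}\mathbf{x}^{m-1}\in\mathbb{R}^n$ is the vector with components $(\mathcal{A}\mathbf{x}^{m-1})_i=\sum_{i_2,\ldots,i_m=1}^n a_{ii_2\cdots i_m}x_{i_2}\cdots x_{i_m}$. Vector inequalities are componentwise. Tensor complementarity problem $(\mathbf{q},\mathcal{A})$, for $\mathbf{q}\in\mathbb{R}^n$: find $\mathbf{x}\in\mathbb{R}^n$ such that $\mathbf{x}\ge\mathbf{0}$, $\mathbf{q}+\mathcal{A}\mathbf{x}^{m-1}\ge\mathbf{0}$ and $\mathbf{x}^\top(\mathbf{q}+\mathcal{A}\mathbf{x}^{m-1})=0$. $\mathcal{A}$ is a Q-tensor iff $(\mathbf{q},\mathcal{A})$ has a solution for every $\mathbf{q}\in\mathbb{R}^n$. $\mathcal{A}$ is an R-tensor iff there are no $\mathbf{x}\in\mathbb{R}^n$ and $t\in\mathbb{R}$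 with $\mathbf{0}\neq\mathbf{x}\ge\mathbf{0}$, $t\ge 0$, such that $(\mathcal{A}\mathbf{x}^{m-1})_i+t=0$ for every $i$ with $x_i>0$ and $(\mathcal{A}\mathbf{x}^{m-1})_j+t\ge 0$ for every $j$ with $x_j=0$. $\mathcal{A}$ is strictly semi-positive iff for each $\mathbf{x}\in\mathbb{R}^n$ with $\mathbf{x}\ge\mathbf{0}$, $\mathbf{x}\ne\mathbf{0}$, there is $k\in I_n$ with $x_k>0$ and $(\mathcal{A}\mathbf{x}^{m-1})_k>0$. *)

(* Defs.v *)
From HB Require Import structures.
From mathcomp Require Import all_boot all_order all_algebra.
From mathcomp Require Import reals.

Set Implicit Arguments.
Unset Strict Implicit.
Unset Printing Implicit Defensive.

Import Order.TTheory GRing.Theory Num.Theory.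
Local Open Scope ring_scope.

(* Indices i_1, ..., i_m range over 'I_n = {0, ..., n-1}. *)
Definition tensor (R : Type) (m n : nat) := {ffun m.-tuple 'I_n -> R}.

Definition vec_ge0 (R : realType) (n : nat) (x : 'cV[R]_n) : Prop :=
  forall i : 'I_n, 0 <= x i 0.

(* (A x^{m-1})_i: summing over the multi-indices w = (i_1, ..., i_m) whose
   first entry is i amounts, for m >= 1, to summing over i_2, ..., i_m; behead w
   is then (i_2, ..., i_m). *)
Definition tensor_app (R : realType) (m n : nat) (A : tensor R m n)
    (x : 'cV[R]_n) : 'cV[R]_n :=
  \col_i \sum_(w : m.-tuple 'I_n | ohead w == Some i)
            A w * \prod_(j <- behead w) x j 0.

Definition TCP_solution (R : realType) (m n : nat) (q : 'cV[R]_n)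
    (A : tensor R m n) (x : 'cV[R]_n) : Prop :=
  [/\ vec_ge0 x, vec_ge0 (q + tensor_app A x)
    & x^T *m (q + tensor_app A x) = 0].

Definition Q_tensor (R : realType) (m n : nat) (A : tensor R m n) : Prop :=
  forall q : 'cV[R]_n, exists x : 'cV[R]_n, TCP_solution q A x.

Definition R_tensor (R : realType) (m n : nat) (A : tensor R m n) : Prop :=
  ~ exists (x : 'cV[R]_n) (t : R),
      [/\ x <> 0, vec_ge0 x, 0 <= t,
          forall i : 'I_n, 0 < x i 0 -> tensor_app A x i 0 + t = 0
        & forall j : 'I_n, x j 0 = 0 -> 0 <= tensor_app A x j 0 + t].

Definition strictly_semi_positive (R : realType) (m n : nat)
    (A : tensor R m n) : Prop :=
  forall x : 'cV[R]_n, vec_ge0 x -> x <> 0 ->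
    exists k : 'I_n, 0 < x k 0 /\ 0 < tensor_app A x k 0.

Definition nonneg_tensor (R : realType) (m n : nat) (A : tensor R m n) : Prop :=
  forall w : m.-tuple 'I_n, 0 <= A w.

Definition diag_entry (R : realType) (m n : nat) (A : tensor R m n)
    (i : 'I_n) : R :=
  A [tuple of nseq m i].

(* Main.v *)
(* The implication from positive diagonal entries to the Q-property is the
   substantial one. For [m = 2] and [q = (-1, ..., -1)] it already contains the
   existence of symmetric Nash equilibria of symmetric bimatrix games, so a
   fixed point argument of Brouwer type is needed; it is supplied by a lemma of
   Scarf: if a finite set [X] carries linear orders indexed by [I] and a
   colouring by [I], then some subset [Y] is such that every [x] of [X] lies
   below all of [Y] for an order whose index is a colour of [Y]. The proof is a
   parity argument as in Sperner's lemma. For the coordinate orders on a fine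
   grid of the simplex, such a [Y] has small diameter and its coordinates
   outside the colours of [Y] are small, so compactness gives a point [x] of
   the simplex with [x i = 0] unless [x] is in the closure of the colour class
   [i]. A point of the simplex is read as a vector of sum at most [M] together
   with a slack coordinate; it is coloured by some [i] with [(q + A x^(m-1))_i
   < 0], or by the slack if there is none. When [M] is large the positive
   diagonal entries force the slack of the limit point to be positive, and the
   closure property is then complementarity. *)
Require Import Defs.
From HB Require Import structures.
From mathcomp Require Import all_boot all_order all_algebra.
From mathcomp Require Import reals.

Set Implicit Arguments.
Unset Strict Implicit.
Unset Printing Implicit Defensive.

Import Order.TTheory GRing.Theory Num.Theory.
Local Open Scope ring_scope.

(** * Dominant sets. A room is a dominant set of [#|I|] elements, a door a set of one element
    fewer *)

Section Dominance.
Local Open Scope nat_scope.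
Variables (I T : finType) (r : I -> T -> nat).
Hypothesis r_inj : forall i, injective (r i).

Definition dominant (Z : {set T}) :=
  [forall x, exists i, forall z in Z, r i x <= r i z].

Lemma dominantP (Z : {set T}) :
  reflect (forall x, exists i, forall z, z \in Z -> r i x <= r i z)
          (dominant Z).
Proof.
apply: (iffP forallP) => dZ x.
  by have /existsP[i /forall_inP] := dZ x; exists i.
by have [i ri] := dZ x; apply/existsP; exists i; apply/forall_inP.
Qed.

Lemma dominantS (Y Z : {set T}) : Y \subset Z -> dominant Z -> dominant Y.
Proof.
move=> /subsetP sYZ /dominantP dZ; apply/dominantP => x.
by have [i ri] := dZ x; exists i => z /sYZ/ri.
Qed.

Definition lowest (Z : {set T}) (m : I -> T) :=
  forall i, m i \in Z /\ (forall z, z \in Z -> r i (m i) <= r i z).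

Lemma lowest_exists (Z : {set T}) : Z != set0 -> exists m, lowest Z m.
Proof.
case/set0Pn=> z0 Zz0; exists (fun i => [arg min_(z < z0 in Z) r i z]) => i.
by case: arg_minnP.
Qed.

Lemma lowest_eq (Z : {set T}) (m : I -> T) (i : I) (z : T) :
  lowest Z m -> z \in Z -> (forall z', z' \in Z -> r i z <= r i z') -> m i = z.
Proof.
move=> lowm Zz zmin; have [Zm mmin] := lowm i.
by apply: (@r_inj i); apply/eqP; rewrite eqn_leq mmin // zmin.
Qed.

(** An element of a dominant set lies below the whole set in some order, hence is its minimum there.
    So a dominant set has at most [#|I|] elements. *)
Lemma lowest_onto (Z : {set T}) (m : I -> T) (z : T) :
  dominant Z -> lowest Z m -> z \in Z -> exists i, m i = z.
Proof.
move=> /dominantP/(_ z)[i zmin] lowm Zz; exists i.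
exact: (lowest_eq lowm).
Qed.

Lemma lowest_imset (Z : {set T}) (m : I -> T) :
  dominant Z -> lowest Z m -> m @: setT = Z.
Proof.
move=> dZ lowm; apply/setP=> z; apply/imsetP/idP => [[i _ ->]|Zz].
  by case: (lowm i).
by have [i <-] := lowest_onto dZ lowm Zz; exists i.
Qed.

(** When [m] gives the minima of a set, adding a point of [above m j] to it can change only the
    minimum of order [j]. *)
Definition above (m : I -> T) (j : I) : {set T} :=
  [set x | [forall i, (i != j) ==> (r i (m i) < r i x)]].

Definition highest (m : I -> T) (j : I) : {set T} :=
  [set x in above m j | [forall z in above m j, r j z <= r j x]].

Lemma aboveP (m : I -> T) (j : I) (x : T) :
  reflect (forall i, i != j -> r i (m i) < r i x) (x \in above m j).
Proof. by rewrite inE; apply: (iffP forall_inP). Qed.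

Lemma highestP (m : I -> T) (j : I) (x : T) :
  reflect (x \in above m j /\ forall z, z \in above m j -> r j z <= r j x)
          (x \in highest m j).
Proof.
apply: (iffP idP) => [|[xj xmax]]; rewrite in_set.
  by case/andP=> xj /forall_inP.
by rewrite xj; apply/forall_inP.
Qed.

Lemma card_highest (m : I -> T) (j : I) :
  #|highest m j| = (above m j != set0).
Proof.
have [m0|/set0Pn[x0 mx0]] := eqVneq (above m j) set0.
  by apply/eqP; rewrite cards_eq0 -subset0 -m0; apply/subsetP=> x /highestP[].
have [x mx xmax] := @arg_maxnP _ x0 (mem (above m j)) (r j) mx0.
apply/eqP/cards1P; exists x; apply/setP=> y; rewrite inE.
apply/highestP/eqP => [[my ymax]|->]; last by split.
by apply: (@r_inj j); apply/eqP; rewrite eqn_leq ymax // andbT; exact: xmax.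
Qed.

Section Door.
Variables (D : {set T}) (m : I -> T) (j1 j2 : I).
Hypotheses (dD : dominant D) (lowm : lowest D m) (cD : #|D|.+1 = #|I|).
Hypotheses (j12 : j1 != j2) (mj12 : m j1 = m j2).

(** As [m] maps [I] onto [D], which has one element fewer, [j1] and [j2] form its only coincidence:
    without either of them, [m] is a bijection onto [D]. *)
Let doubled j := (j == j1) || (j == j2).

Let card_setD1 (j : I) : #|[set~ j]| = #|D|.
Proof. by rewrite cardsC1 -cD. Qed.

Let imset_doubled j : doubled j -> m @: [set~ j] = D.
Proof.
move=> dj; apply/setP=> z; apply/imsetP/idP => [[i _ ->]|Dz].
  by case: (lowm i).
have [i mi] := lowest_onto dD lowm Dz.
have [ij|] := eqVneq i j; last by exists i; rewrite // !inE.
move: dj mi; rewrite ij => /orP[]/eqP -> <-.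
  by exists j2; rewrite // !inE eq_sym.
by exists j1; rewrite // !inE.
Qed.

Let doubled_inj j : doubled j -> {in [set~ j] &, injective m}.
Proof. by move=> dj; apply/imset_injP; rewrite imset_doubled // card_setD1. Qed.

Let above_notin j x : doubled j -> x \in above m j -> x \notin D.
Proof.
move=> dj /aboveP xj; apply/negP => Dx.
have := Dx; rewrite -(imset_doubled dj) => /imsetP[i].
by rewrite !inE => ij xi; have := xj i ij; rewrite xi ltnn.
Qed.

Let highest_dominant j x : x \in highest m j -> dominant (x |: D).
Proof.
case/highestP=> /aboveP xj xmax; apply/dominantP=> z.
have [/xmax zx|] := boolP (z \in above m j).
  exists j => y /setU1P[->//|Dy]; apply: leq_trans zx _.
  (* The order in which [x] lies below [D] can only be [j], since [x] exceeds the minima of all the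
     others. *)
  have /dominantP/(_ x)[i xmin] := dD.
  have [<-|ij] := eqVneq i j; first exact: xmin.
  by have [Dm _] := lowm i; have := xmin _ Dm; rewrite leqNgt xj.
rewrite inE negb_forall => /existsP[i]; rewrite negb_imply -leqNgt.
case/andP=> ij zi; exists i => y /setU1P[->|Dy].
  by apply: leq_trans zi _; apply/ltnW/xj.
by apply: leq_trans zi _; case: (lowm i) => _; apply.
Qed.

(** The minima [m'] of the larger set are pairwise distinct and agree with those of [D] except in
    the order [j] where [x] is lowest. So [j] must break the coincidence of [j1] and [j2]. A point
    of [above m j] higher than [x] would violate dominance. *)
Let dominant_highest x : x \notin D -> dominant (x |: D) ->
  exists2 j, doubled j & x \in highest m j.
Proof.
move=> Dx dxD.
have [m' lowm'] : exists m', lowest (x |: D) m'.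
  by apply: lowest_exists; apply/set0Pn; exists x; rewrite setU11.
have m'_inj : injective m'.
  suff: {in setT &, injective m'} by move=> h i j; apply: h; rewrite inE.
  by apply/imset_injP; rewrite (lowest_imset dxD lowm') cardsU1 Dx cardsT -cD.
have [j m'j] := lowest_onto dxD lowm' (setU11 _ _).
have m'D i : i != j -> m' i = m i.
  move=> ij; have [/setU1P[|Dm' m'min]] := lowm' i.
    by rewrite -m'j => /m'_inj/eqP; rewrite (negPf ij).
  by apply/esym/(lowest_eq lowm) => // z Dz; apply: m'min; rewrite setU1r.
have dj : doubled j.
  apply/negPn/negP; rewrite /doubled negb_or => /andP[jj1 jj2].
  have := m'_inj j1 j2; rewrite !m'D; [|by rewrite eq_sym..].
  by move=> /(_ mj12)/eqP; rewrite (negPf j12).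
exists j => //; apply/highestP; split.
  apply/aboveP=> i ij; rewrite -m'D // ltn_neqAle.
  have [_ -> //] := lowm' i; last by rewrite setU11.
  by rewrite andbT -[X in _ != r i X]m'j (inj_eq (@r_inj i)) (inj_eq m'_inj).
move=> z /aboveP zj; rewrite leqNgt; apply/negP=> xz.
have /dominantP/(_ z)[i zmin] := dxD.
have [ij|ij] := eqVneq i j.
  by have := zmin x (setU11 _ _); rewrite ij leqNgt xz.
have [Dm _] := lowm i; have := zmin _ (setU1r x Dm).
by rewrite leqNgt zj.
Qed.

(** Each of [j1] and [j2] contributes one room unless its set [above] is empty. The two rooms
    differ, since a point common to both would exceed every minimum of [D], against dominance. *)
Lemma card_door_rooms : #|[set x | (x \notin D) && dominant (x |: D)]| =
  (above m j1 != set0) + (above m j2 != set0).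
Proof.
have -> : [set x | (x \notin D) && dominant (x |: D)] =
          highest m j1 :|: highest m j2.
  apply/setP=> x; rewrite in_set in_setU; apply/andP/orP.
    by case=> Dx /(dominant_highest Dx)[j /orP[]/eqP ->]; [left|right].
  have rooms j : doubled j -> x \in highest m j ->
      x \notin D /\ dominant (x |: D).
    by move=> dj xj; split; [case/highestP: xj => /(above_notin dj)|
       exact: highest_dominant xj].
  by case=> /rooms; apply; rewrite /doubled eqxx ?orbT.
rewrite cardsU !card_highest disjoint_setI0 ?cards0 ?subn0 //.
rewrite disjoints_subset; apply/subsetP=> x xj1; rewrite in_setC.
apply/negP=> /highestP[/aboveP xj2 _].
have [/aboveP xj1' _] := highestP _ _ _ xj1.
have /dominantP/(_ x)[i xmin] := dD; have [Dm _] := lowm i.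
have := xmin _ Dm; rewrite leqNgt; apply/negP/negPn.
have [ij1|] := eqVneq i j1; last exact: xj1'.
by apply: xj2; rewrite ij1.
Qed.

End Door.

Lemma doubled_exists (D : {set T}) (m : I -> T) :
  lowest D m -> #|D| < #|I| -> exists j1 j2, j1 != j2 /\ m j1 = m j2.
Proof.
move=> lowm cD; have : ~~ injectiveb m.
  apply/negP=> /injectiveP m_inj; move: cD; rewrite ltnNge => /negP; apply.
  rewrite -(card_imset _ m_inj).
  apply/subset_leq_card/subsetP=> _ /imsetP[i _ ->].
  by case: (lowm i).
by case/injectivePn=> j1 [j2 j12 mj12]; exists j1, j2.
Qed.

Section Coloring.
Variables (c : T -> I) (i0 : I).

(** If removing [z0] leaves exactly the colours other than [i0], each once, then the colour of [z0]
    is shared by exactly one other point [z1]. The doors are then obtained by removing [z0] or [z1],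
    so there are none or two. *)
Lemma even_doors (Z : {set T}) : #|Z| = #|I| -> c @: Z != setT ->
  ~~ odd #|[set z in Z | c @: (Z :\ z) == [set~ i0]]|.
Proof.
move=> cZ cZT; set W := [set z in Z | _].
have [->|/set0Pn[z0]] := eqVneq W set0; first by rewrite cards0.
rewrite inE => /andP[Zz0 /eqP cz0].
have c_inj : {in Z :\ z0 &, injective c}.
  by apply/imset_injP; rewrite cz0 cardsC1 -cZ (cardsD1 z0 Z) Zz0.
have : c z0 \in c @: (Z :\ z0).
  rewrite cz0 !inE; apply: contra cZT => /eqP cz0i.
  by rewrite -(setD1K Zz0) imsetU1 cz0 cz0i setUCr.
case/imsetP=> z1 Zz1 cz01; have := Zz1; rewrite !inE => /andP[z10 Zz1'].
have -> : W = [set z0; z1]; last by rewrite cards2 eq_sym z10.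
apply/setP=> z; rewrite !inE; apply/andP/orP.
  case=> Zz /eqP cz; have [->|zz0] := eqVneq z z0; [by left|right].
  have : c z \in c @: (Z :\ z).
    by rewrite cz -cz0; apply: imset_f; rewrite !inE zz0.
  case/imsetP=> z'; rewrite !inE => /andP[z'z Zz'] czz'.
  apply/eqP; apply: (c_inj); rewrite ?inE ?zz0 ?z10 // -cz01 czz'.
  have [-> //|z'z0] := eqVneq z' z0.
  by case/eqP: z'z; apply: (c_inj); rewrite ?inE ?zz0 ?z'z0.
case=> /eqP->; first by rewrite Zz0 cz0.
split=> //; apply/eqP; rewrite -cz0; apply/setP=> i.
apply/imsetP/imsetP => -[y]; rewrite !inE => /andP[yz Zy] ->.
  have [->|yz0] := eqVneq y z0; first by exists z1; rewrite // !inE z10.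
  by exists y; rewrite ?inE ?yz0.
have [->|yz1] := eqVneq y z1; first by exists z0; rewrite // !inE eq_sym z10.
by exists y; rewrite ?inE ?yz1.
Qed.

(** Both sides count the incidences of rooms with doors of colours [[set~ i0]], by the bijection
    between pairs [(Z, z)] and [(Z :\ z, z)]. *)
Lemma double_count :
  \sum_(Z : {set T} | (#|Z| == #|I|) && dominant Z)
     #|[set z in Z | c @: (Z :\ z) == [set~ i0]]| =
  \sum_(D : {set T} | (#|D|.+1 == #|I|) && (c @: D == [set~ i0]))
     #|[set z | (z \notin D) && dominant (z |: D)]|.
Proof.
under eq_bigr do rewrite -sum1_card.
under [RHS]eq_bigr do rewrite -sum1_card.
rewrite (exchange_big_dep predT) //= [RHS](exchange_big_dep predT) //=.
apply: eq_bigr => z _.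
rewrite (reindex_onto (fun D => z |: D) (fun Z => Z :\ z)); last first.
  by move=> Z; rewrite inE => /and3P[_ Zz _]; rewrite setD1K.
apply: eq_bigl => D; rewrite !inE eqxx /=.
have [Dz|Dz] := boolP (z \in D).
  rewrite andbF /=; apply/negP => /andP[_ /eqP] DD.
  by have := setD11 z (z |: D); rewrite DD Dz.
by rewrite setU1K // eqxx cardsU1 Dz add1n andbT /= andbAC -!andbA.
Qed.

End Coloring.

End Dominance.

(** * Scarf's lemma by parity *)

Section Scarf.
Local Open Scope nat_scope.
Variables (I X : finType) (r : I -> X -> nat) (c : X -> I) (x0 : X).
Hypothesis r_inj : forall i, injective (r i).
Hypothesis I_gt1 : 1 < #|I|.

Let bound := \sum_i \sum_x (r i x).+1.

(* The slack [inr k] is the least element for the order [k] and lies above all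
   of [X] for the others; among themselves the slacks are ordered arbitrarily. *)
Definition slack_rank (i : I) (z : X + I) : nat :=
  match z with
  | inl x => (r i x).+1
  | inr k => if k == i then 0 else (bound + enum_rank k).+1
  end.

Definition slack_color (z : X + I) : I :=
  match z with inl x => c x | inr k => k end.

Let rank_le_bound i x : (r i x).+1 <= bound.
Proof. by rewrite /bound (bigD1 i) //= (bigD1 x) //= -addnA leq_addr. Qed.

Lemma slack_rank_inj (i : I) : injective (slack_rank i).
Proof.
have lt_slack x (k : I) : (r i x).+1 <> (bound + enum_rank k).+1.
  move=> rx; have := rank_le_bound i x; rewrite rx ltnNge.
  by rewrite leq_addr.
move=> [x|k] [y|l] //=.
- by case=> /r_inj ->.
- by case: eqP => // _ /lt_slack.
- by case: eqP => // _ /esym/lt_slack.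
case: eqP => [->|_]; case: eqP => [->|_] //.
by case=> /addnI/ord_inj/enum_rank_inj ->.
Qed.

Let i0 := c x0.
(** This is the outer door of the parity argument, the only one with an odd number of rooms. *)
Let slacks : {set X + I} := inr @: [set~ i0].

Let card_slacks : #|slacks|.+1 = #|I|.
Proof.
rewrite card_imset; last exact: inr_inj.
by rewrite cardsC1 prednK // ltnW.
Qed.

Let in_slacks k : (inr k \in slacks) = (k != i0).
Proof. by rewrite mem_imset ?inE //; exact: inr_inj. Qed.

(** A door that is not dominant has no room. Otherwise it contains some [inl x], because [inr i0]
    has a forbidden colour and [D] is as large as [slacks]. Then each [inr j] exceeds the minima in
    all orders but [j], so both sides of the door have a room. *)
Lemma even_door (D : {set X + I}) : #|D|.+1 = #|I| ->
  slack_color @: D = [set~ i0] -> D != slacks ->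
  ~~ odd #|[set z | (z \notin D) && dominant slack_rank (z |: D)]|.
Proof.
move=> cD colD Ds.
have [dD|ndD] := boolP (dominant slack_rank D); last first.
  rewrite (_ : [set z | _] = set0) ?cards0 //.
  apply/setP=> z; rewrite !inE; apply: contraNF ndD => /andP[_].
  by apply: dominantS; exact: subsetUr.
have D0 : D != set0 by rewrite -card_gt0 -ltnS cD.
have [m lowm] := lowest_exists slack_rank D0.
have [|j1 [j2 [j12 mj]]] := doubled_exists lowm; first by rewrite -cD.
have [x Dx] : exists x, inl x \in D.
  have : ~~ (D \subset slacks).
    apply: contra Ds => Ds; rewrite eqEcard Ds.
    by rewrite -ltnS cD card_slacks /=.
  case/subsetPn=> [[x|k]] Dk; first by exists x.
  rewrite in_slacks => /negPn/eqP ki; have := imset_f slack_color Dk.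
  by rewrite colD !inE /= ki eqxx.
have abv j : above slack_rank m j != set0.
  apply/set0Pn; exists (inr j); apply/aboveP=> i ij.
  have [_ /(_ _ Dx) mx] := lowm i.
  apply: leq_ltn_trans mx _; rewrite /= eq_sym (negPf ij) ltnS.
  exact: leq_trans (rank_le_bound _ _) (leq_addr _ _).
by rewrite (card_door_rooms slack_rank_inj dD lowm cD j12 mj) !abv.
Qed.

(** The coincidence is between [i0] and the order [j] whose slack is lowest for [i0]. Every point of
    [X] is above on the side of [i0]. On the side of [j] nothing is: points of [X] are below [inr j]
    in the order [i0], and any other slack is least in its own order. *)
Lemma odd_slacks :
  odd #|[set z | (z \notin slacks) && dominant slack_rank (z |: slacks)]|.
Proof.
have dS : dominant slack_rank slacks.
  apply/dominantP=> -[x|k].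
    exists i0 => z /imsetP[k]; rewrite !inE => ki ->.
    rewrite /= (negPf ki) ltnS; apply: leq_trans (leq_addr _ _).
    exact: ltnW (rank_le_bound _ _).
  by exists k => z _; rewrite /= eqxx.
have S0 : slacks != set0 by rewrite -card_gt0 -ltnS card_slacks.
have [m lowm] := lowest_exists slack_rank S0.
have mE k : k != i0 -> m k = inr k.
  move=> ki; apply: (lowest_eq slack_rank_inj lowm); first by rewrite in_slacks.
  by move=> z _; rewrite /= eqxx.
have [/imsetP[j]] := lowm i0; rewrite !inE => ji mi0 _.
have ij : i0 != j by rewrite eq_sym.
rewrite (card_door_rooms slack_rank_inj dS lowm card_slacks ij); last first.
  by rewrite mi0 mE.
have -> : above slack_rank m i0 != set0.
  by apply/set0Pn; exists (inl x0); apply/aboveP=> i ii; rewrite mE //= eqxx.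
suff -> : above slack_rank m j = set0 by rewrite eqxx.
apply/setP=> z; rewrite in_set0; apply/negP=> /aboveP zj.
case: z zj => [x|l] zj.
  have := zj i0 ij; rewrite mi0 /= (negPf ji) ltnS => rx.
  have := leq_trans rx (ltnW (rank_le_bound i0 x)).
  by rewrite leqNgt ltnS leq_addr.
have [lj|lj] := eqVneq l j; first by have := zj i0 ij; rewrite mi0 lj ltnn.
by have := zj l lj; rewrite /= eqxx.
Qed.

Lemma fully_colored_dominant :
  exists Z : {set X + I}, dominant slack_rank Z /\ slack_color @: Z = setT.
Proof.
have [/existsP[Z /andP[dZ /eqP cZ]]|] :=
  boolP [exists Z, dominant slack_rank Z && (slack_color @: Z == setT)].
  by exists Z.
rewrite negb_exists => /forallP noZ.
have := double_count slack_rank slack_color i0.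
set lhs := (X in X = _) => lhsE; suff : odd lhs.
  suff /negPf-> : ~~ odd lhs by [].
  rewrite /lhs; elim/big_ind: _ => // [a b|Z].
    by rewrite oddD => /negPf-> /negPf->.
  case/andP=> /eqP cZ dZ; apply: even_doors => //.
  by have := noZ Z; rewrite dZ.
rewrite lhsE (bigD1 slacks) /=; last first.
  rewrite card_slacks eqxx /=; apply/eqP/setP=> i.
  by rewrite -imset_comp imset_id.
rewrite oddD odd_slacks addTb; elim/big_ind: _ => // [a b|D].
  by rewrite oddD => /negPf-> /negPf->.
by move=> /andP[/andP[/eqP cD /eqP colD] Ds]; exact: even_door.
Qed.

Lemma scarf : exists Y : {set X},
  forall x, exists2 i, i \in c @: Y & forall y, y \in Y -> r i x <= r i y.
Proof.
have [Z [/dominantP dZ cZ]] := fully_colored_dominant.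
exists [set x | inl x \in Z] => x; have [i xmin] := dZ (inl x).
exists i; last by move=> y; rewrite inE => /xmin.
have : i \in slack_color @: Z by rewrite cZ.
case/imsetP=> -[y|k] Zk /= ik; first by rewrite ik; apply: imset_f; rewrite inE.
(* A slack [inr i] in [Z] has rank 0 in the order [i], so [inl x] cannot lie below it. *)
by have := xmin _ Zk; rewrite /= -ik eqxx.
Qed.

End Scarf.

(** * Scarf's lemma on the integer grid of a simplex *)

Section Grid.
Local Open Scope nat_scope.
Variables (N K : nat) (c : {ffun 'I_N -> 'I_K.+1} -> 'I_N).
Hypothesis N_gt1 : 1 < N.

Let grid := {x : {ffun 'I_N -> 'I_K.+1} | \sum_i x i == K}.

Let grid_point (f : 'I_N -> nat) : \sum_i f i = K ->
  exists x : grid, forall i, val x i = f i :> nat.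
Proof.
move=> fK; pose x : {ffun 'I_N -> 'I_K.+1} := [ffun i => inord (f i)].
have xE i : x i = f i :> nat.
  by rewrite ffunE inordK // ltnS -fK (bigD1 i) //= leq_addr.
have xK : \sum_i x i == K by rewrite -[eqbRHS]fK; apply/eqP/eq_bigr => i _.
by exists (Sub x xK : grid).
Qed.

Let grid_dominant : exists2 Y : {set grid}, Y != set0 & forall x : grid,
  exists2 i, i \in (c \o val) @: Y & forall y, y \in Y -> val x i <= val y i.
Proof.
(* Ties between equal coordinates are broken by enumeration; dividing by the size of the grid
   recovers the coordinate. *)
pose r (i : 'I_N) (x : grid) := val x i * #|{: grid}| + enum_rank x.
have rdiv i x : r i x %/ #|{: grid}| = val x i.
  have xG : enum_rank x < #|{: grid}| by rewrite ltn_ord.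
  by rewrite /r divnMDl ?divn_small ?addn0 // (leq_ltn_trans _ xG).
have rmod i x : r i x %% #|{: grid}| = enum_rank x.
  by rewrite /r modnMDl modn_small // ltn_ord.
have r_inj i : injective (r i).
  move=> x y rxy; apply/enum_rank_inj/ord_inj.
  by rewrite -(rmod i x) rxy rmod.
have i0 : 'I_N by exists 0; rewrite ltnW.
have [x0 _] : exists x : grid, forall i, val x i = (i == i0) * K :> nat.
  apply: grid_point; rewrite (bigD1 i0) //= eqxx mul1n big1 ?addn0 //.
  by move=> i /negPf->.
have [|Y domY] := scarf (c \o val) x0 r_inj; first by rewrite card_ord.
exists Y => [|x].
  have [i /imsetP[y Yy _] _] := domY x0.
  by apply/set0Pn; exists y.
have [i iY xmin] := domY x; exists i => // y /xmin rxy.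
by rewrite -!rdiv leq_div2r.
Qed.

Lemma grid_scarf : exists p : {ffun 'I_N -> 'I_K.+1}, \sum_i p i = K /\
  forall i, N < p i -> exists q : {ffun 'I_N -> 'I_K.+1},
    c q = i /\ forall j, p j <= q j + N /\ q j <= p j + N.
Proof.
have [Y Y0 domY] := grid_dominant; set J := _ @: Y in domY.
have [y0 Yy0] := set0Pn _ Y0; have Jj0 : c (val y0) \in J by apply: imset_f.
set j0 := c _ in Jj0.
have [m lowm] := lowest_exists (fun i (x : grid) => val x i) Y0.
pose lo i := val (m i) i : nat.
have J_large : K < \sum_(i in J) (lo i).+1.
  rewrite ltnNge; apply/negP=> JK.
  (* Otherwise some grid point exceeds the minima [lo] in every coordinate of [J], the surplus going
     to [j0]. No colour of [Y] could then place it below [Y]. *)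
  have [x xE] : exists x : grid, forall i, val x i =
      (if i \in J then (lo i).+1 else 0) +
      (i == j0) * (K - \sum_(i in J) (lo i).+1) :> nat.
    apply: grid_point; rewrite big_split /= -big_mkcond /=.
    rewrite [X in _ + X](bigD1 j0) //= eqxx mul1n.
    rewrite [X in _ + (_ + X)]big1 ?addn0 ?subnKC //.
    by move=> i /negPf->.
  have [i Ji xmin] := domY x; have [Ym _] := lowm i.
  have := xmin _ Ym; rewrite xE Ji addSn => lt_lo.
  by have := leq_ltn_trans (leq_addr _ _) lt_lo; rewrite ltnn.
(* All of [Y] lies above the corner [d], whose coordinate sum is more than [K - N]. So each point of
   [Y] is within [N] of [d] in every coordinate, which bounds both the diameter of [Y] and the
   coordinates outside [J]. *)
pose d i := if i \in J then lo i else 0.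
have d_le y i : y \in Y -> d i <= val y i.
  by rewrite /d => Yy; case: ifP => // _; have [_] := lowm i; apply.
have le_d y i : y \in Y -> val y i <= d i + N.
  move=> Yy; have /eqP yK := valP y.
  have : \sum_k val y k < \sum_k d k + N.
    rewrite yK; apply: leq_trans J_large _.
    under eq_bigr do rewrite -addn1.
    rewrite big_split /= big_mkcond /= leq_add2l sum1_card.
    by rewrite -[leqRHS]card_ord max_card.
  rewrite (bigD1 i) //= [X in _ < X + _](bigD1 i) //= addnAC => lt_d.
  have le_rest : \sum_(k < N | k != i) d k <= \sum_(k < N | k != i) val y k.
    by apply: leq_sum => k _; exact: d_le.
  rewrite -(leq_add2r (\sum_(k < N | k != i) d k)).
  by apply: leq_trans (ltnW lt_d); rewrite leq_add2l.
have close y y' i : y \in Y -> y' \in Y -> val y i <= val y' i + N.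
  by move=> Yy Yy'; apply: leq_trans (le_d _ _ Yy) _; rewrite leq_add2r d_le.
exists (val y0); split; first exact/eqP/(valP y0).
move=> i Ni; have Ji : i \in J.
  apply: contraLR Ni => Ji; rewrite -leqNgt.
  by have := le_d _ i Yy0; rewrite /d (negPf Ji).
have [y Yy ->] := imsetP Ji; exists (val y); split=> // j.
by split; apply: close.
Qed.

End Grid.

From mathcomp Require Import ring lra boolp classical_sets functions.
From mathcomp Require Import topology normedtype.
Import numFieldNormedType.Exports.

(** * Passage to the limit in the simplex *)

Section KKM.
Local Open Scope classical_set_scope.
Local Open Scope ring_scope.

(** The point is a cluster point of those found on the grids of mesh [1 / k.+1], where the error [N]
    of the grid lemma becomes [n.+2 / k.+1]. *)
Lemma kkm (R : realType) (n : nat) (c : 'rV[R]_n.+2 -> 'I_n.+2) :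
  exists x : 'rV[R]_n.+2,
    [/\ forall i, 0 <= x 0 i, \sum_i x 0 i = 1
      & forall i, 0 < x 0 i -> closure [set z | c z = i] x].
Proof.
pose pt K (p : {ffun 'I_n.+2 -> 'I_K.+1}) : 'rV[R]_n.+2 :=
  \row_i ((p i)%:R / K%:R).
have /choice[u uP] : forall k, exists u : 'rV[R]_n.+2,
    [/\ forall i, 0 <= u 0 i, \sum_i u 0 i = 1
      & forall i, n.+2%:R / k.+1%:R < u 0 i -> exists z, c z = i /\
        forall j, `|u 0 j - z 0 j| <= n.+2%:R / k.+1%:R].
  move=> k; have [//|p [pK pP]] := grid_scarf (fun p => c (pt k.+1 p)).
  have k_gt0 : 0 < k.+1%:R^-1 :> R by rewrite invr_gt0.
  exists (pt _ p); split=> [i||i]; first by rewrite mxE divr_ge0.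
    under eq_bigr do rewrite mxE.
    by rewrite -mulr_suml -natr_sum pK divff // pnatr_eq0.
  rewrite mxE ltr_pM2r // ltr_nat => /pP[q [cq pq]].
  exists (pt _ q); split=> // j; rewrite !mxE -mulrBl normrM (gtr0_norm k_gt0).
  rewrite ler_pM2r // ler_norml lerNl opprB !lerBlDl -!natrD !ler_nat.
  by have [-> ->] := pq j.
pose cube := [set v : 'rV[R]_n.+2 | forall i, [set` `[0 : R, 1]] (v ord0 i)].
have u_ge0 k := let: And3 h _ _ := uP k in h.
have u_sum k := let: And3 _ h _ := uP k in h.
have u_le1 k i : u k 0 i <= 1.
  by rewrite -(u_sum k) (bigD1 i) //= lerDl sumr_ge0.
have cube_compact : compact cube.
  exact: (rV_compact (fun=> @segment_compact R 0 1)).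
have [|x [xcube xclus]] := cube_compact (u @ \oo) _.
  by exists 0%N => // k _ i; rewrite /= in_itv /= u_ge0 u_le1.
have often (e : R) K : 0 < e -> exists2 k, (K <= k)%N &
    forall i, `|x 0 i - u k 0 i| < e.
  move=> e0.
  have uK : (u @ \oo) (u @` [set k | (K <= k)%N]).
    by exists K => // k /= Kk; exists k.
  have [_ [[k Kk <-] [_ xk]]] := xclus _ _ uK (nbhsx_ballx x e e0).
  by exists k => // i; have := xk 0 i; rewrite -ball_normE.
exists x; split=> [i||i xi].
- by have /= := xcube i; rewrite in_itv => /andP[].
- apply/eqP; rewrite -subr_eq0 -normr_eq0 eq_le normr_ge0 andbT.
  apply/ler_addgt0Pl => e e0; rewrite addr0.
  have e'0 : 0 < e / n.+2%:R by rewrite divr_gt0.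
  have [k _ xk] := often _ 0%N e'0.
  rewrite -(u_sum k) -sumrB; apply: le_trans (ler_norm_sum _ _ _) _.
  apply: (@le_trans _ _ (\sum_(i < n.+2) (e / n.+2%:R))).
    by apply: ler_sum => i _; exact: ltW.
  by rewrite sumr_const card_ord -[_ *+ _]mulr_natr divfK // pnatr_eq0.
move=> B /nbhs_ballP[e /= e0 eB].
(* The bound [e / 2] puts [z] in the ball, going through [u k]; the bound [x 0 i / 2] keeps
   [u k 0 i] above the grid error, so that colour [i] occurs near [u k]. *)
pose d := Num.min (e / 2) (x 0 i / 2).
have d0 : 0 < d by rewrite lt_min !divr_gt0.
have [K NK] : exists K, n.+2%:R / d < K%:R.
  exists (Num.bound (n.+2%:R / d)); apply: archi_boundP.
  by rewrite divr_ge0 // ltW.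
have [k Kk xk] := often d K d0.
have small : n.+2%:R / k.+1%:R < d.
  rewrite ltr_pdivrMr // mulrC -ltr_pdivrMr //; apply: lt_le_trans NK _.
  by rewrite ler_nat ltnW // ltnS.
have [_ _ /(_ i)] := uP k; case.
  apply: lt_trans small _.
  have := xk i; rewrite ltr_norml => /andP[_].
  have : d <= x 0 i / 2 by rewrite ge_min lexx orbT.
  lra.
move=> z [cz uz]; exists z; split=> //; apply: eB; split=> // a j.
rewrite ord1 -ball_normE /=.
have -> : x 0 j - z 0 j = (x 0 j - u k 0 j) + (u k 0 j - z 0 j) by ring.
apply: le_lt_trans (ler_normD _ _) _.
have d_le : d <= e / 2 by rewrite ge_min lexx.
apply: lt_le_trans (ltrD (xk j) (le_lt_trans (uz j) small)) _.
lra.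
Qed.

End KKM.

(** * Nonnegative tensors and their diagonal *)

Section Tensor.
Local Open Scope ring_scope.
Variables (R : realType) (m n : nat) (A : tensor R m n).
Hypothesis m_ge2 : (2 <= m)%N.

Lemma tensor_app_diag (x : 'cV[R]_n) (i : 'I_n) :
  tensor_app A x i 0 = diag_entry A i * x i 0 ^+ m.-1 +
    \sum_(w : m.-tuple 'I_n | (ohead w == Some i) && (w != [tuple of nseq m i]))
       A w * \prod_(j <- behead w) x j 0.
Proof.
rewrite mxE (bigD1 [tuple of nseq m i]) /=; last by case: m m_ge2.
congr (_ * _ + _); rewrite (_ : behead _ = nseq m.-1 i); last by case: m m_ge2.
by rewrite big_nseq -Monoid.iteropE.
Qed.

(** An off-diagonal multi-index starting with [k] has a later entry other than [k], where [x]
    vanishes. *)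
Lemma tensor_app_axis (x : 'cV[R]_n) (k : 'I_n) :
  (forall j, j != k -> x j 0 = 0) ->
  tensor_app A x k 0 = diag_entry A k * x k 0 ^+ m.-1.
Proof.
move=> x0; rewrite tensor_app_diag big1 ?addr0 // => w /andP[wk wnk].
suff : has (fun j => j != k) (behead w).
  case/hasP=> j wj jk; rewrite (big_rem j) //= x0 // mul0r mulr0 //.
apply: contraR wnk; rewrite -all_predC => /allP wk'; apply/eqP/val_inj => /=.
have sw : size w = m by rewrite size_tuple.
case: (val w) sw wk wk' => [<- //|a s] <- /= /eqP[->] sk.
by congr cons; apply/all_pred1P/allP => j /sk /=; rewrite negbK.
Qed.

Hypothesis A_ge0 : nonneg_tensor A.

Lemma tensor_app_ge0 (x : 'cV[R]_n) (i : 'I_n) :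
  vec_ge0 x -> 0 <= tensor_app A x i 0.
Proof.
move=> x0; rewrite mxE sumr_ge0 // => w _; rewrite mulr_ge0 //.
by rewrite prodr_ge0.
Qed.

Lemma diag_le_tensor_app (x : 'cV[R]_n) (i : 'I_n) :
  vec_ge0 x -> diag_entry A i * x i 0 ^+ m.-1 <= tensor_app A x i 0.
Proof.
move=> x0; rewrite tensor_app_diag lerDl sumr_ge0 // => w _.
rewrite mulr_ge0 //.
by rewrite prodr_ge0.
Qed.

Lemma strictly_semi_positive_diag :
  (forall i, 0 < diag_entry A i) -> strictly_semi_positive A.
Proof.
move=> A0 x x0 xn0; have [k xk] : exists k, 0 < x k 0.
  apply/existsP; apply: contra_notT xn0; rewrite negb_exists => /forallP xle.
  apply/colP=> i; rewrite mxE; apply/le_anti.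
  by rewrite x0 andbT leNgt xle.
exists k; split=> //; apply: lt_le_trans (diag_le_tensor_app k x0).
by rewrite mulr_gt0 // exprn_gt0.
Qed.

Lemma strictly_semi_positive_R : strictly_semi_positive A -> R_tensor A.
Proof.
move=> A0 [x [t [xn0 x0 t0 xt _]]]; have [k [xk Axk]] := A0 x x0 xn0.
by have := ltr_wpDr t0 Axk; rewrite xt // ltxx.
Qed.

Lemma R_diag : R_tensor A -> forall i, 0 < diag_entry A i.
Proof.
move=> RA k; rewrite lt_neqAle A_ge0 andbT; apply/negP => /eqP Ak.
(* If the diagonal entry at [k] vanishes, the unit vector on axis [k] with [t = 0] violates the
   R-property. *)
apply: RA; exists (delta_mx k 0), 0.
have dE j : j != k -> (delta_mx k 0 : 'cV[R]_n) j 0 = 0.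
  by move=> /negPf jk; rewrite mxE jk.
have d0 : vec_ge0 (delta_mx k 0 : 'cV[R]_n) by move=> i; rewrite mxE ler0n.
split=> // [/colP/(_ k)|i|j _].
- by move/eqP; rewrite !mxE !eqxx oner_eq0.
- have [->|/dE->] := eqVneq i k; last by rewrite ltxx.
  by rewrite (tensor_app_axis dE) -Ak mul0r addr0.
- by rewrite addr0 tensor_app_ge0.
Qed.

Lemma Q_diag : Q_tensor A -> forall i, 0 < diag_entry A i.
Proof.
move=> QA k; rewrite lt_neqAle A_ge0 andbT; apply/negP => /eqP Ak.
(* Outside [k] the slack [q + A x^(m-1)] is at least 1, so complementarity puts [x] on axis [k];
   with a zero diagonal entry the component at [k] is then -1. *)
have [x [x0 qx xqx]] := QA (\col_i (if i == k then -1 else 1)).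
have xE i : i != k -> x i 0 = 0.
  move=> ik; have := congr1 (fun M : 'M_1 => M 0 0) xqx; rewrite !mxE.
  move/eqP; rewrite psumr_eq0 => [|j _]; last by rewrite mulr_ge0 // mxE.
  move/allP/(_ i (mem_index_enum _)) => /=; rewrite mulf_eq0 mxE.
  case/orP=> /eqP // /eqP; rewrite mxE mxE (negPf ik) gt_eqF //.
  by rewrite ltr_wpDr // tensor_app_ge0.
have := qx k; rewrite mxE (tensor_app_axis xE) -Ak mul0r addr0 mxE eqxx.
by rewrite ler0N1.
Qed.

End Tensor.

(** * Positive diagonal entries give the Q-property *)

Section Existence.
Local Open Scope classical_set_scope.
Local Open Scope ring_scope.

Lemma tensor_app_continuous (R : realType) (T : topologicalType) (m n : nat)
    (A : tensor R m n) (y : T -> 'cV[R]_n) (i : 'I_n) :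
  (forall j, continuous (fun z => y z j 0)) ->
  continuous (fun z => tensor_app A (y z) i 0).
Proof.
move=> yc; rewrite (_ : (fun z => _) = fun z =>
    \sum_(w : m.-tuple 'I_n | ohead w == Some i)
       A w * \prod_(j <- behead w) y z j 0); last first.
  by apply/funext=> z; rewrite mxE.
apply: continuous_big => [p|w _ z]; first exact: add_continuous.
apply: cvgM; first exact: cvg_cst.
apply: cvg_big => [p|j _]; first exact: mul_continuous.
exact: yc.
Qed.

Lemma diag_gt0_Q (R : realType) (m n : nat) (A : tensor R m n) :
  (2 <= m)%N -> (1 <= n)%N -> nonneg_tensor A ->
  (forall i, 0 < diag_entry A i) -> Q_tensor A.
Proof.
case: n A => // n A m_ge2 _ A_ge0 diag_gt0 q.
(* For [B] as below, the diagonal entry times [B] exceeds [|q i 0|], and [B >= 1] makes powers of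
   numbers above [B] no smaller than the numbers. The factor [n.+2] in [M] turns a simplex
   coordinate of at least [1 / n.+2] into an entry of [y] of at least [B]. *)
pose a i := `|q i 0| / diag_entry A i.
have a_ge0 i : 0 <= a i by rewrite divr_ge0 // ltW.
pose B := 1 + \sum_i a i; pose M := n.+2%:R * B.
have B_ge1 : 1 <= B by rewrite lerDl sumr_ge0.
have M_gt0 : 0 < M by rewrite mulr_gt0 // (lt_le_trans ltr01).
pose y (z : 'rV[R]_n.+2) : 'cV[R]_n.+1 := \col_i (M * z 0 (lift ord0 i)).
pose G i z := q i 0 + tensor_app A (y z) i 0.
have Gc i : continuous (G i).
  have yc j : continuous (fun z => y z j 0).
    rewrite (_ : (fun z => y z j 0) = fun z => M * z 0 (lift ord0 j));
      last by apply/funext=> z; rewrite mxE.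
    move=> z; apply: (@continuousM _ _ (cst M)); first exact: cst_continuous.
    exact: coord_continuous.
  move=> z; apply: (@continuousD _ _ _ (cst (q i 0))).
    exact: cst_continuous.
  exact: tensor_app_continuous.
pose c z := if [pick i | G i z < 0] is Some i then lift ord0 i else ord0.
have cS i z : c z = lift ord0 i -> G i z <= 0.
  by rewrite /c; case: pickP => [j /ltW Gj /lift_inj <-|_ /eqP] //.
have c0 i z : c z = ord0 -> 0 <= G i z.
  rewrite /c; case: pickP => [j _ /eqP|Gz _]; first by [].
  by have := Gz i; rewrite leNgt => ->.
have [x [x_ge0 x_sum xc]] := kkm c.
have x_le0 i : 0 < x 0 (lift ord0 i) -> G i x <= 0.
  (* The colour class lies in a closed set, which therefore contains its closure. *)
  have GC : closed (G i @^-1` [set t | t <= 0]).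
    by apply: preimage_closed; [move=> z _; exact: Gc|exact: closed_le].
  by move=> /xc/(closureS (cS i)); rewrite -((closure_id _).1 GC).
have x_ge i : 0 < x 0 ord0 -> 0 <= G i x.
  have GC : closed (G i @^-1` [set t | 0 <= t]).
    by apply: preimage_closed; [move=> z _; exact: Gc|exact: closed_ge].
  by move=> /xc/(closureS (c0 i)); rewrite -((closure_id _).1 GC).
have y_ge0 : vec_ge0 (y x) by move=> i; rewrite mxE mulr_ge0 // ltW.
have x0_gt0 : 0 < x 0 ord0.
  (* Without slack some other coordinate is at least [1 / n.+2]. The diagonal term then outweighs
     [q] and makes [G i x] positive, against [x_le0]. *)
  rewrite lt_neqAle x_ge0 andbT; apply/negP=> /eqP x00.
  have [i xi] : exists i, n.+2%:R^-1 <= x 0 (lift ord0 i).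
    apply/existsP; rewrite -[X in is_true X]negbK negb_exists.
    apply/negP=> /forallP x_small.
    suff : \sum_i x 0 i < 1 by rewrite x_sum ltxx.
    have -> : 1 = \sum_(i < n.+2) n.+2%:R^-1 :> R.
      by rewrite sumr_const card_ord -[_ *+ _]mulr_natr mulVf // pnatr_eq0.
    rewrite big_ord_recl [ltRHS]big_ord_recl -x00 ltr_leD // ?invr_gt0 //.
    by apply: ler_sum => i _; rewrite ltW // ltNge.
  have yi : B <= y x i 0.
    rewrite mxE /M mulrAC ler_peMl ?(le_trans ler01) //.
    by rewrite mulrC -ler_pdivrMr // div1r.
  have xi_gt0 : 0 < x 0 (lift ord0 i).
    by apply: lt_le_trans xi; rewrite invr_gt0.
  have := x_le0 i xi_gt0; rewrite leNgt /G => /negP; apply.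
  have d0 := diag_gt0 i.
  have : diag_entry A i * B <= tensor_app A (y x) i 0.
    apply: le_trans (diag_le_tensor_app m_ge2 A_ge0 i y_ge0).
    rewrite ler_pM2l //; apply: le_trans (_ : y x i 0 <= _); first exact: yi.
    apply: ler_eXnr; last exact: le_trans yi.
    by case: (m) m_ge2 => [|[]].
  have : diag_entry A i + `|q i 0| <= diag_entry A i * B.
    rewrite /B mulrDr mulr1 lerD2l (bigD1 i) //= mulrDr /a mulrCA.
    rewrite divff ?gt_eqF // mulr1 lerDl mulr_ge0 ?(ltW d0) // sumr_ge0 // => j _.
    exact: a_ge0.
  have := ler_norm (- q i 0); rewrite normrN.
  lra.
have GE : q + tensor_app A (y x) = \col_i G i x.
  by apply/colP=> i; rewrite mxE [RHS]mxE.
exists (y x); split=> //; first by move=> i; rewrite GE mxE x_ge.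
apply/matrixP=> i j; rewrite !ord1 GE !mxE big1 // => k _; rewrite !mxE.
have [->|xk] := eqVneq (x 0 (lift ord0 k)) 0; first by rewrite mulr0 mul0r.
suff -> : G k x = 0 by rewrite mulr0.
by apply/le_anti; rewrite x_ge // andbT x_le0 // lt_neqAle eq_sym xk x_ge0.
Qed.

End Existence.

Theorem corollary3p8 (R : realType) (m n : nat) (hm : (2 <= m)%N)
    (hn : (1 <= n)%N) (A : tensor R m n) (hA : nonneg_tensor A) :
  [/\ Q_tensor A <-> R_tensor A,
      R_tensor A <-> strictly_semi_positive A
    & strictly_semi_positive A <-> (forall i : 'I_n, 0 < diag_entry A i)].
Proof.
have QD := Q_diag hm hA; have RD := R_diag hm hA.
have DS := strictly_semi_positive_diag hm hA.
have SR := @strictly_semi_positive_R R m n A.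
have DQ := diag_gt0_Q hm hn hA.
by split; split; auto.
Qed.
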